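(* Let $\mathcal G$ be an infinite family of finite connected graphs such that $C(G)=\Theta(h_{\max}(G)\log n)$ over $G\in\mathcal G$, where $n=|V(G)|$; that is, there are constants $a_1,a_2>0$ and $N_0$ such that $a_1 h_{\max}(G)\log n\le C(G)\le a_2 h_{\max}(G)\log n$ for all $G\in\mathcal G$ with $n\ge N_0$. Then $S^k(G)=\Omega(k)$ for all $k\le\log n$; that is, there are constants $c>0$ and $N$ such that $S^k(G)\ge c\,k$ for every $G\in\mathcal G$ with $n\ge N$ and every integer $1\le k\le\log n$.
   Context: A simple random walk on a finite graph moves at each step from the current vertex to a uniformly random neighbor. For a finite connected graph $G$, a vertex $i$ and an integer $k\ge 1$, let $\tau_i^k$ be the first time by which every vertex of $G$ has been visited by at least one of $k$ independent simple random walks, all started at $i$ at time $0$ and moving simultaneously (the vertex occupied at time $0$ counts as visited). Put $C_i^k=E[\tau_i^k]$, $C^k(G)=\max_i C_i^k$, and $C(G)=C^1(G)$ (the cover time). The speed-up is $S^k(G)=C(G)/C^k(G)$. The hitting time $h(u,v)$ is the expected time for a simple random walk started at $u$ to first reach $v$, and $h_{\max}(G)=\max_{u,v}h(u,v)$. $\log$ denotes the natural logarithm. *)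

(* Defs.v *)
From HB Require Import structures.
From mathcomp Require Import all_boot all_order all_algebra.
From mathcomp Require Import all_classical all_reals all_analysis.
From mathcomp Require Import lra.

Set Implicit Arguments.
Unset Strict Implicit.
Unset Printing Implicit Defensive.

Import Order.TTheory GRing.Theory Num.Theory.
Local Open Scope classical_set_scope.
Local Open Scope ring_scope.

Record sgraph := SGraph {
  vertex :> finType;
  edge : rel vertex;
  edge_sym : symmetric edge;
  edge_irrefl : irreflexive edge }.

Definition connected_graph (G : sgraph) : Prop :=
  (0 < #|G|)%N /\ forall x y : G, connect (@edge G) x y.

Definition degree (G : sgraph) (x : G) : nat := #|[pred y | edge x y]|.

(* An isolated vertex has no neighbour to move to; by convention the walk then
   stays put.  Among connected graphs this concerns the one-vertex graph only. *)
Definition srw_step (R : realType) (G : sgraph) (x y : G) : R :=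
  if degree x == 0%N then (x == y)%:R else (edge x y)%:R / (degree x)%:R.

Section Processes.
Context d (Omega : measurableType d) (R : realType) (P : probability Omega R).

(* The last field says that, conditionally on the past X_0 = x_0, ...,
   X_t = x_t, the next position is distributed as [srw_step x_t]; it is
   multiplied out so as not to divide by a null probability. *)
Record simple_random_walk (G : sgraph) (i : G) (X : nat -> Omega -> G) : Prop := {
  srw_measurable : forall t x, measurable (X t @^-1` [set x]);
  srw_start : P [set w | X 0%N w = i] = 1%E;
  srw_markov : forall (t : nat) (x : nat -> G),
    P [set w | forall s, (s <= t.+1)%N -> X s w = x s] =
    (P [set w | forall s, (s <= t)%N -> X s w = x s] *
     (srw_step R (x t) (x t.+1))%:E)%E }.

Definition process_sigma_algebra (S : Type) (X : nat -> Omega -> S) :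
    set (set Omega) :=
  <<s [set A | exists t x, A = X t @^-1` [set x]] >>.

Definition independent_processes (S : Type) (k : nat)
    (X : 'I_k -> nat -> Omega -> S) : Prop :=
  forall (J : {set 'I_k}) (A : 'I_k -> set Omega),
    (forall j, j \in J -> process_sigma_algebra (X j) (A j)) ->
    P (\bigcap_(j in [set` J]) A j) = (\prod_(j in J) P (A j))%E.

End Processes.

Record walks (R : realType) (G : sgraph) (k : nat) (i : G) := Walks {
  walks_display : measure_display;
  walks_space : measurableType walks_display;
  walks_prob : probability walks_space R;
  walk : 'I_k -> nat -> walks_space -> G;
  walk_srw : forall j, simple_random_walk walks_prob i (walk j);
  walk_indep : independent_processes walks_prob walk }.

Arguments walk {R G k i} _ _ _ _.

(* +oo when [Q] never holds *)
Definition first_time (R : realType) (Q : nat -> Prop) : \bar R :=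
  ereal_inf [set (t%:R : R)%:E | t in Q].

Definition covered_by (G : sgraph) (k : nat) (Omega : Type)
    (X : 'I_k -> nat -> Omega -> G) (w : Omega) (t : nat) : Prop :=
  forall v : G, exists j s, (s <= t)%N /\ X j s w = v.

(* The quantities below are expectations with respect to a given choice [W] of
   k independent walks for every graph, k and starting vertex.  They depend
   only on the law of the walks, and [walks_exist] below shows that such
   choices exist. *)
Definition walks_choice (R : realType) : Type :=
  forall (G : sgraph) (k : nat) (i : G), walks R k i.

Section CoverTimes.
Context (R : realType) (W : walks_choice R) (G : sgraph).
Local Open Scope ereal_scope.

Definition cover_time_from (k : nat) (i : G) : \bar R :=
  \int[walks_prob (W k i)]_w first_time R (covered_by (walk (W k i)) w).

Definition kcover_time (k : nat) : \bar R :=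
  \big[maxe/-oo]_(i : G) cover_time_from k i.

Definition cover_time : \bar R := kcover_time 1%N.

(* For 0 < k, the denominator is finite and positive on a connected graph with at least
   two vertices. *)
Definition speedup (k : nat) : \bar R := cover_time / kcover_time k.

Definition hitting_time (u v : G) : \bar R :=
  \int[walks_prob (W 1%N u)]_w first_time R (fun t => walk (W 1%N u) ord0 t w = v).

Definition max_hitting_time : \bar R :=
  \big[maxe/-oo]_(u : G) \big[maxe/-oo]_(v : G) hitting_time u v.

End CoverTimes.

(* Existence of the walks.  A single chain is read off a uniform w in [0, 1[ by
   splitting [0, 1[ into nested subintervals, one for each finite trajectory,
   whose length is the probability of that trajectory; k independent walks are
   then obtained on product spaces. *)
Section Chain.
Context (R : realType) (V : finType) (p : V -> V -> R) (i : V).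
Hypothesis p_ge0 : forall x y, 0 <= p x y.
Hypothesis p_sum1 : forall x, \sum_y p x y = 1.

Let cumul x n := \sum_(z | (enum_rank z < n)%N) p x z.

Let cumul0 x : cumul x 0 = 0.
Proof. by rewrite /cumul big_pred0. Qed.

Let cumulT x : cumul x #|V| = 1.
Proof. by rewrite -(p_sum1 x); apply: eq_bigl => z; rewrite ltn_ord. Qed.

Let cumulS x y : cumul x (enum_rank y).+1 = cumul x (enum_rank y) + p x y.
Proof.
rewrite /cumul (bigD1 y)//= addrC; congr (_ + _); apply: eq_bigl => z.
rewrite ltnS ltn_neqAle andbC; congr (_ && _).
by apply/idP/idP; apply: contra => /eqP h; apply/eqP;
  [exact/enum_rank_inj/val_inj | rewrite h].
Qed.

Let le_cumul x m n : (m <= n)%N -> cumul x m <= cumul x n.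
Proof.
move=> mn; rewrite /cumul [leRHS](bigID (fun z => (enum_rank z < m)%N))/=.
rewrite [leLHS](eq_bigl (fun z => (enum_rank z < n) && (enum_rank z < m))%N).
  by rewrite lerDl sumr_ge0.
by move=> z; case: (ltnP (enum_rank z) m) => [/leq_trans->//|_]; rewrite andbF.
Qed.

Let cumul_ge0 x n : 0 <= cumul x n. Proof. exact: sumr_ge0. Qed.

Let cumul_le1 x (y : V) : cumul x (enum_rank y).+1 <= 1.
Proof. by rewrite -(cumulT x); exact: le_cumul. Qed.

Let cell (a l : R) (x : V) (w : R) (y : V) :=
  (a + l * cumul x (enum_rank y) <= w) && (w < a + l * cumul x (enum_rank y).+1).

Let cell_inj a l x w y z : 0 <= l -> cell a l x w y -> cell a l x w z -> y = z.
Proof.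
move=> l0 /andP[y1 y2] /andP[z1 z2]; apply/enum_rank_inj/val_inj => /=.
case: (ltngtP (enum_rank y) (enum_rank z)) => // h; exfalso.
- have := ler_wpM2l l0 (le_cumul x h); lra.
- have := ler_wpM2l l0 (le_cumul x h); lra.
Qed.

Let cell_ex a l x w : a <= w < a + l -> exists y, cell a l x w y.
Proof.
move=> /andP[aw wl].
have exn : exists n, w < a + l * cumul x n by exists #|V|; rewrite cumulT mulr1.
case: (ex_minnP exn) => -[|n] wn minn.
  by move: wn; rewrite cumul0 mulr0 addr0 ltNge aw.
have nV : (n < #|V|)%N by apply: minn; rewrite cumulT mulr1.
exists (enum_val (Ordinal nV)); rewrite /cell enum_valK/= wn andbT.
by rewrite leNgt; apply/negP => /minn; rewrite ltnn.
Qed.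

Let move w (s : V * R * R) : V * R * R :=
  let: (x, a, l) := s in
  if [pick y | cell a l x w y] is Some y
  then (y, a + l * cumul x (enum_rank y), l * p x y) else s.

Let state t w := iter t (move w) (i, 0, 1).

Let chain t w : V := (state t w).1.1.

Let bounds (x : nat -> V) t : R * R :=
  iteri t (fun s al => (al.1 + al.2 * cumul (x s) (enum_rank (x s.+1)),
                        al.2 * p (x s) (x s.+1))) (0, 1).

Let boundsS x t : bounds x t.+1 =
  ((bounds x t).1 + (bounds x t).2 * cumul (x t) (enum_rank (x t.+1)),
   (bounds x t).2 * p (x t) (x t.+1)).
Proof. by []. Qed.

Let bounds_ge0 x t : 0 <= (bounds x t).2.
Proof. by elim: t => [|t IH]; rewrite ?ler01// boundsS mulr_ge0. Qed.

Let bounds_in x t : 0 <= (bounds x t).1 /\ (bounds x t).1 + (bounds x t).2 <= 1.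
Proof.
elim: t => [|t [IH1 IH2]]; first by rewrite /= add0r.
rewrite boundsS/=; split; first by rewrite addr_ge0// mulr_ge0.
rewrite -addrA -mulrDr -cumulS (le_trans _ IH2)// lerD2l.
by rewrite ler_piMr.
Qed.

Let state_cell x t w :
  (bounds x t.+1).1 <= w < (bounds x t.+1).1 + (bounds x t.+1).2 ->
  cell (bounds x t).1 (bounds x t).2 (x t) w (x t.+1).
Proof. by rewrite boundsS/= /cell cumulS mulrDr addrA. Qed.

Let chainP x t w : 0 <= w < 1 ->
  [/\ (forall s, (s <= t)%N -> chain s w = x s) ->
      state t w = (x t, (bounds x t).1, (bounds x t).2),
      (forall s, (s <= t)%N -> chain s w = x s) ->
      x 0%N = i /\ (bounds x t).1 <= w < (bounds x t).1 + (bounds x t).2 &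
      x 0%N = i /\ (bounds x t).1 <= w < (bounds x t).1 + (bounds x t).2 ->
      (forall s, (s <= t)%N -> chain s w = x s)].
Proof.
move=> w01; elim: t => [|t [IH1 IH2 IH3]].
  split.
  - by move=> /(_ 0%N (leqnn _)) <-.
  - by move=> /(_ 0%N (leqnn _)) <-; rewrite /= add0r.
  - by move=> [xi _] s; rewrite leqn0 => /eqP ->.
have key : (forall s, (s <= t)%N -> chain s w = x s) ->
    exists2 y, cell (bounds x t).1 (bounds x t).2 (x t) w y &
    state t.+1 w = (y, (bounds x t).1 + (bounds x t).2 * cumul (x t) (enum_rank y),
                    (bounds x t).2 * p (x t) y).
  move=> xs; have [xi inb] := IH2 xs.
  rewrite /state iterS -/(state t w) (IH1 xs) /move.
  case: pickP => [y cy|nc]; first by exists y.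
  by have [y] := cell_ex (x t) inb; rewrite nc.
have sub : (forall s, (s <= t.+1)%N -> chain s w = x s) ->
    forall s, (s <= t)%N -> chain s w = x s.
  by move=> h s st; apply: h; exact: leqW.
split.
- move=> h; have [y _ e] := key (sub h).
  have := h t.+1 (leqnn _); rewrite /chain e/= => yx.
  by rewrite -yx.
- move=> h; have [y cy e] := key (sub h).
  have [xi _] := IH2 (sub h); split => //.
  have := h t.+1 (leqnn _); rewrite /chain e/= => yx.
  by move: cy; rewrite /cell -yx cumulS mulrDr addrA.
- move=> [xi inb].
  have cx := state_cell inb.
  have xs : forall s, (s <= t)%N -> chain s w = x s.
    apply: IH3; split => //; move: cx => /andP[c1 c2].
    have b0 := bounds_ge0 x t.
    rewrite (le_trans _ c1) ?lerDl ?mulr_ge0//=.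
    by rewrite (lt_le_trans c2)// lerD2l ler_piMr.
  have [y cy e] := key xs.
  move=> s; rewrite leq_eqVlt ltnS => /predU1P[->|/xs//].
  by rewrite /chain e/=; exact: cell_inj cy cx.
Qed.

Let chain_out t w : ~~ (0 <= w < 1) -> chain t w = i.
Proof.
move=> w01; rewrite /chain; suff -> : state t w = (i, 0, 1) by [].
elim: t => // t IH; rewrite -[state t.+1 w]/(move w (state t w)) IH /move.
case: pickP => // y /andP[]; rewrite !add0r !mul1r => h1 h2; case/negP: w01.
by rewrite (le_trans _ h1)//= (lt_le_trans h2).
Qed.

Let cyl x t : set R := [set w | forall s, (s <= t)%N -> chain s w = x s].

Let cyl_in x t : cyl x t `&` `[0, 1[ =
  if x 0%N == i then [set` `[(bounds x t).1, (bounds x t).1 + (bounds x t).2[ ]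
  else set0.
Proof.
have [b0 b1] := bounds_in x t.
apply/seteqP; split => w /=.
  move=> [cw]; rewrite in_itv/= => w01; have [_ + _] := chainP x t w01.
  by move=> /(_ cw)[-> h]; rewrite eqxx/= in_itv.
case: eqP => // xi; rewrite /= !in_itv/= => h.
have w01 : 0 <= w < 1.
  by case/andP: h => h1 h2; rewrite (le_trans b0)//= (lt_le_trans h2).
by split=> //; have [_ _] := chainP x t w01; apply.
Qed.

Let measurable_cyl x t : measurable (cyl x t : set (measurableTypeR R)).
Proof.
rewrite -[cyl x t](setUIDK _ `[0, 1[%classic).
apply: measurableU.
  by rewrite cyl_in; case: ifP.
have [xi|xi] := pselect (forall s, (s <= t)%N -> x s = i).
  rewrite (_ : _ `\` _ = ~` `[0, 1[%classic); first exact: measurableC.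
  apply/seteqP; split => w /= => [[]//|w01]; split => // s st.
  by rewrite chain_out ?xi//; apply/negP; move: w01; rewrite in_itv.
rewrite (_ : _ `\` _ = set0)//; apply/seteqP; split => w //= -[cw].
rewrite in_itv/= => /negP w01; apply: xi => s st.
by rewrite -cw// chain_out.
Qed.

Let P : probability (measurableTypeR R) R := uniform_prob (@ltr01 R).

Let P_cyl x t : P (cyl x t) = (if x 0%N == i then (bounds x t).2 else 0)%:E.
Proof.
have Pi (A : set R) : measurable (A : set (measurableTypeR R)) ->
    P A = lebesgue_measure (A `&` `[0, 1[).
  have P0 (B : set R) : measurable (B : set (measurableTypeR R)) ->
      B `<=` `[0, 1] -> P B = lebesgue_measure B.
    move=> mB B01; rewrite /P /= /uniform_prob.
    rewrite (eq_integral (fun=> 1%E)) ?integral_cst ?mul1e//.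
    move=> w /set_mem /B01 /=; rewrite in_itv/= /uniform_pdf => ->.
    by rewrite subr0 invr1.
  have m01 : measurable (`[0, 1[%classic : set (measurableTypeR R)) by [].
  have P01 : P (~` `[0, 1[%classic) = 0%E.
    rewrite probability_setC// P0//; last exact: subset_itv_co_cc.
    by rewrite lebesgue_measure_itv/= lte_fin ltr01 oppr0 adde0 subee.
  move=> mA; rewrite -P0; last 2 first.
  - exact: measurableI.
  - by move=> w [_] /subset_itv_co_cc.
  rewrite -[in LHS](setUIDK A `[0, 1[%classic) measureU//; last 3 first.
  - exact: measurableI.
  - exact: measurableD.
  - by rewrite setDE setIACA setICr setI0.
  rewrite [X in (_ + X)%E](_ : _ = 0%E) ?adde0//.
  apply/eqP; rewrite eq_le measure_ge0 andbT -P01.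
  by apply: le_measure; rewrite ?inE; [exact: measurableD | exact: measurableC | move=> ? []].
rewrite Pi// cyl_in; case: ifP => _; last by rewrite measure0.
rewrite lebesgue_measure_itv/= lte_fin ltrDl lt_neqAle bounds_ge0 andbT.
by case: eqP => [<-//|_]; rewrite -EFinD addrAC subrr add0r.
Qed.

Let measurable_chain t x :
  measurable (chain t @^-1` [set x] : set (measurableTypeR R)).
Proof.
rewrite (_ : _ @^-1` _ = \bigcup_(f in [set f : {ffun 'I_t.+1 -> V} | f ord_max = x])
    cyl (fun s => f (inord s)) t).
  by apply: fin_bigcup_measurable => // f _; exact: measurable_cyl.
apply/seteqP; split => w /=.
  move=> cx; exists [ffun s : 'I_t.+1 => chain s w]; first by rewrite /= ffunE.
  by move=> s st; rewrite ffunE inordK.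
move=> [f /= <-] /(_ t (leqnn _)) ->; congr (f _).
by apply: val_inj; rewrite /= inordK.
Qed.

Lemma chain_exists : exists X : nat -> measurableTypeR R -> V,
  [/\ forall t x, measurable (X t @^-1` [set x]),
      P [set w | X 0%N w = i] = 1%E &
      forall t x, P [set w | forall s, (s <= t.+1)%N -> X s w = x s] =
        (P [set w | forall s, (s <= t)%N -> X s w = x s] *
         (p (x t) (x t.+1))%:E)%E].
Proof.
exists chain; split=> [t x||t x]; first exact: measurable_chain.
  by rewrite (_ : [set _ | _] = setT) ?probability_setT// -subTset.
have := P_cyl x t; have := P_cyl x t.+1; rewrite /cyl => -> ->.
by rewrite boundsS/= -EFinM; case: ifP; rewrite ?mul0r.
Qed.

End Chain.

Lemma srw_step_ge0 (R : realType) (G : sgraph) (x y : G) : 0 <= srw_step R x y.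
Proof. by rewrite /srw_step; case: ifP => _; rewrite ?ler0n// divr_ge0. Qed.

Lemma srw_step_sum1 (R : realType) (G : sgraph) (x : G) :
  \sum_y srw_step R x y = 1.
Proof.
rewrite /srw_step; case: eqVneq => d0.
  rewrite (bigD1 x)//= eqxx big1 ?addr0// => y.
  by rewrite eq_sym => /negbTE ->.
rewrite -mulr_suml -natr_sum (_ : \sum_y _ = degree x)%N.
  by rewrite mulfV// pnatr_eq0.
rewrite /degree -sum1_card [RHS]big_mkcond/=; apply: eq_bigr => y _.
by rewrite inE; case: edge.
Qed.

Section transfer.
Context d1 d2 (T1 : measurableType d1) (T2 : measurableType d2) (R : realType).
Context (P1 : probability T1 R) (P2 : probability T2 R) (f : T2 -> T1).
Hypothesis mf : forall A, measurable A -> measurable (f @^-1` A).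
Hypothesis Pf : forall A, measurable A -> P2 (f @^-1` A) = P1 A.

Lemma srw_comp (G : sgraph) (i : G) (X : nat -> T1 -> G) :
  simple_random_walk P1 i X -> simple_random_walk P2 i (fun t => X t \o f).
Proof.
move=> [mX X0 XS].
have mcyl t (x : nat -> G) :
    measurable [set w | forall s, (s <= t)%N -> X s w = x s].
  rewrite (_ : [set _ | _] =
    \bigcap_s (if (s <= t)%N then X s @^-1` [set x s] else setT)).
    by apply: bigcapT_measurable => s; case: ifP.
  apply/seteqP; split=> w /= h s; first by case: ifP => // /h.
  by move=> st; have := h s I; rewrite st.
split=> [t x||t x].
- by rewrite comp_preimage; exact/mf/mX.
- by rewrite -X0 -Pf//; exact: (mX 0%N i).
- by have := XS t x; rewrite -!Pf.
Qed.

Lemma process_sigma_comp (S : Type) (X : nat -> T1 -> S) A :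
  process_sigma_algebra (fun t => X t \o f) A ->
  exists2 B, process_sigma_algebra X B & A = f @^-1` B.
Proof.
move=> /(_ (preimage_set_system setT f (process_sigma_algebra X))) [].
  split; first exact/sigma_algebra_preimage/smallest_sigma_algebra.
  move=> _ [t [x ->]]; exists (X t @^-1` [set x]).
    by apply: sub_sigma_algebra; exists t, x.
  by rewrite setTI comp_preimage.
by move=> B sB <-; exists B => //; rewrite setTI.
Qed.

Lemma process_sigma_measurable (G : sgraph) (i : G) (X : nat -> T1 -> G) A :
  simple_random_walk P1 i X -> process_sigma_algebra X A -> measurable A.
Proof.
move=> [mX _ _]; apply; split; first exact: sigma_algebra_measurable.
by move=> _ [t [x ->]].
Qed.

End transfer.

Lemma one_walk (R : realType) (G : sgraph) (i : G) :
  exists X : nat -> measurableTypeR R -> G,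
    simple_random_walk (uniform_prob (@ltr01 R)) i X.
Proof.
have [X [mX X0 XS]] := chain_exists i (@srw_step_ge0 R G) (@srw_step_sum1 R G).
by exists X; split.
Qed.

Section product.
Context d1 d2 (T1 : measurableType d1) (T2 : measurableType d2) (R : realType).
Context (P1 : probability T1 R) (P2 : probability T2 R).
Context (G : sgraph) (i : G) (k : nat).
Context (X : nat -> T1 -> G) (Y : 'I_k -> nat -> T2 -> G).
Hypothesis Xsrw : simple_random_walk P1 i X.
Hypothesis Ysrw : forall j, simple_random_walk P2 i (Y j).
Hypothesis Yindep : independent_processes P2 Y.

Let Z (j : 'I_k.+1) : nat -> T1 * T2 -> G :=
  if unlift ord0 j is Some j' then fun t => Y j' t \o snd
  else fun t => X t \o fst.

Let Z0 : Z ord0 = fun t => X t \o fst.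
Proof. by rewrite /Z unlift_none. Qed.

Let ZS j : Z (lift ord0 j) = fun t => Y j t \o snd.
Proof. by rewrite /Z liftK. Qed.

Let m1 A : measurable A -> measurable (@fst T1 T2 @^-1` A).
Proof. by move=> mA; rewrite -[X in measurable X]setTI; exact: measurable_fst. Qed.

Let m2 A : measurable A -> measurable (@snd T1 T2 @^-1` A).
Proof. by move=> mA; rewrite -[X in measurable X]setTI; exact: measurable_snd. Qed.

Let PX A B : measurable A -> measurable B ->
  (P1 \x P2)%E (fst @^-1` A `&` snd @^-1` B) = (P1 A * P2 B)%E.
Proof. by move=> mA mB; rewrite -product_measure1E. Qed.

Let PX1 A : measurable A -> (P1 \x P2)%E (fst @^-1` A) = P1 A.
Proof.
move=> mA; rewrite -[RHS]mule1 -(probability_setT P2) -PX//.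
by rewrite preimage_setT setIT.
Qed.

Let PX2 B : measurable B -> (P1 \x P2)%E (snd @^-1` B) = P2 B.
Proof.
move=> mA; rewrite -[RHS]mul1e -(probability_setT P1) -PX//.
by rewrite preimage_setT setTI.
Qed.

Lemma walks_product : exists Z : 'I_k.+1 -> nat -> T1 * T2 -> G,
  (forall j, simple_random_walk (P1 \x P2)%E i (Z j)) /\
  independent_processes (P1 \x P2)%E Z.
Proof.
exists Z; split=> [j|J A sA].
  case: (unliftP ord0 j) => [j'|] ->; rewrite ?Z0 ?ZS.
  - exact: (srw_comp m2 PX2).
  - exact: (srw_comp m1 PX1).
have [B0 [mB0 A0]] : exists B, measurable B /\ (ord0 \in J -> A ord0 = fst @^-1` B).
  have [J0|_] := boolP (ord0 \in J); last by exists setT.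
  have := sA _ J0; rewrite Z0 => /process_sigma_comp[B sB ->].
  by exists B; split=> //; exact: process_sigma_measurable Xsrw sB.
have /choice[B hB] j : exists B, lift ord0 j \in J ->
    process_sigma_algebra (Y j) B /\ A (lift ord0 j) = snd @^-1` B.
  have [Jj|_] := boolP (lift ord0 j \in J); last by exists setT.
  by have := sA _ Jj; rewrite ZS => /process_sigma_comp[B sB ->]; exists B.
pose J' : {set 'I_k} := [set j | lift ord0 j \in J]%SET.
have mB j : lift ord0 j \in J -> measurable (B j).
  by move=> /hB[sB _]; exact: process_sigma_measurable (Ysrw j) sB.
pose B0' := if ord0 \in J then B0 else setT.
have -> : \bigcap_(j in [set` J]) A j =
    fst @^-1` B0' `&` snd @^-1` (\bigcap_(j in [set` J']) B j).
  apply/seteqP; split=> w /=.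
    move=> h; split.
      by rewrite /B0'; case: ifPn => // J0; have := h _ J0; rewrite A0.
    move=> j /=; rewrite inE => Jj; have := h _ Jj.
    by have [_ ->] := hB _ Jj.
  move=> [h0 h] j /= Jj; case: (unliftP ord0 j) => [j'|] jE; rewrite jE in Jj *.
    by have [_ ->] := hB _ Jj; apply: (h j'); rewrite /= inE.
  by rewrite A0//=; move: h0; rewrite /B0' Jj.
rewrite [LHS]PX; last 2 first.
- by rewrite /B0'; case: ifP.
- by apply: fin_bigcap_measurable => // j; rewrite /= inE => /mB.
rewrite Yindep; last by move=> j; rewrite inE => /hB[].
rewrite [RHS]big_mkcond big_ord_recl/=; congr (_ * _)%E.
  rewrite /B0'; case: ifPn => [J0|_]; last exact: probability_setT.
  by rewrite A0// [RHS]PX1.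
rewrite -big_mkcond/=; apply: eq_big => [j|j]; first by rewrite inE.
by rewrite inE => Jj; have [_ ->] := hB _ Jj; rewrite [RHS]PX2//; exact: mB.
Qed.

End product.

Lemma walks_exist (R : realType) : inhabited (walks_choice R).
Proof.
suff h (G : sgraph) k (i : G) : exists _ : walks R k i, True.
  by constructor => G k i; case: (cid (h G k i)).
elim: k => [|k [W _]].
  unshelve eexists; last by [].
  apply: (@Walks R G 0 i _ _ (uniform_prob (@ltr01 R))
    (fun j => match j with Ordinal _ jk => match notF jk with end end)).
  - by case.
  - move=> J A _; rewrite big1 => [|[]//].
    rewrite (_ : \bigcap_(_ in _) _ = setT) ?probability_setT//.
    by apply/seteqP; split=> // w _ [].
have [X Xsrw] := one_walk R i.
have [Z [Z1 Z2]] := walks_product Xsrw (walk_srw W) (walk_indep (w := W)).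
by exists (Walks Z1 Z2).
Qed.

(* Main.v *)
(* By Markov's inequality a walk misses a given vertex during m = O(h_max)
   steps with probability at most 1/e, from any starting vertex; so k walks all
   miss it during r m steps with probability at most e^(-r k).  A union bound
   over the n vertices makes the tail of the k-walk cover time geometric, in
   units of m, from r = O(log n / k) on.  Hence
   C^k(G) = O(h_max (log n / k + 1)) = O(h_max log n / k) for k <= log n, which
   is O(C(G) / k) by hypothesis. *)

Require Import Defs.
From HB Require Import structures.
From mathcomp Require Import all_boot all_order all_algebra.
From mathcomp Require Import all_classical all_reals all_analysis.
From mathcomp Require Import lra.

Set Implicit Arguments.
Unset Strict Implicit.
Unset Printing Implicit Defensive.

Import Order.TTheory GRing.Theory Num.Theory.
Local Open Scope classical_set_scope.
Local Open Scope ring_scope.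

(** * Expected first times as tail sums; finite partitions and unions of events *)

Section FirstTime.
Context d (T : measurableType d) (R : realType) (P : probability T R).
Local Open Scope ereal_scope.

(** A time T with values in the naturals or +oo is the sum over t of the indicators of T > t; [B] is
    that indicator. If [Q] never holds, all terms are 1 and both sides are +oo. *)
Lemma first_time_sum (Q : nat -> Prop) (B : nat -> bool) :
  (forall t, B t <-> (forall s, (s <= t)%N -> ~ Q s)) ->
  first_time R Q = \sum_(0 <= t <oo) (B t)%:R%:E.
Proof.
move=> QB; have [[t0 Qt0]|nQ] := pselect (exists t, Q t); last first.
  rewrite /first_time (_ : [set _ | _ in _] = set0); last first.
    by rewrite -subset0 => y [t Qt] _; apply: nQ; exists t.
  rewrite ereal_inf0; apply/esym/eqyP => A A0.
  have -> : \sum_(0 <= t <oo) (B t)%:R%:E = \sum_(0 <= t <oo) (1%R : R)%:E.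
    by apply: eq_eseriesr => t _; rewrite (_ : B t)//; apply/QB => s _ Qs;
      apply: nQ; exists s.
  (* A positive real [A] lies below the partial sum of [Num.truncn A + 1] ones. *)
  apply: le_trans (nneseries_lim_ge (Num.truncn A).+1 _) => //.
  rewrite sumEFin big_const_nat subn0 iter_addr addr0 lee_fin.
  exact/ltW/truncnS_gt.
have [t Qt min_t] : exists2 t, Q t & forall s, Q s -> (t <= s)%N.
  have ex : exists t, `[< Q t >] by exists t0; exact/asboolP.
  case: (ex_minnP ex) => t /asboolP Qt h; exists t => // s Qs.
  exact/h/asboolP.
have BE s : B s = (s < t)%N.
  apply/idP/idP => [/QB nQ|st].
    by rewrite ltnNge; apply/negP => ts; exact: nQ ts Qt.
  by apply/QB => r rs /min_t; rewrite leqNgt (leq_ltn_trans rs st).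
have -> : first_time R Q = t%:R%:E.
  apply/eqP; rewrite eq_le; apply/andP; split.
    by apply: ereal_inf_lbound; exists t.
  by apply: le_ereal_inf_tmp => _ [s Qs <-]; rewrite lee_fin ler_nat min_t.
rewrite (nneseries_split 0 t) ?add0n => [|k _]; last by rewrite lee_fin.
rewrite [X in _ + X]eseries0 ?adde0 => [|s ts _]; last first.
  by rewrite BE ltnNge ts.
rewrite (eq_big_nat _ _ (F2 := fun=> 1%:E)) => [|s /andP[_ st]]; last by rewrite BE st.
by rewrite sumEFin big_const_nat subn0 iter_addr addr0.
Qed.

(** Integrate the indicator sum term by term, which is legitimate because the terms are
    nonnegative. *)
Lemma expectation_first_time (Q : T -> nat -> Prop) :
  (forall t, measurable [set w | forall s, (s <= t)%N -> ~ Q w s]) ->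
  \int[P]_w first_time R (Q w) =
  \sum_(0 <= t <oo) P [set w | forall s, (s <= t)%N -> ~ Q w s].
Proof.
move=> mQ; pose A t := [set w | forall s, (s <= t)%N -> ~ Q w s].
under eq_integral => w _.
  rewrite (@first_time_sum _ (fun t => w \in A t)); last first.
    by move=> t; split=> [/set_mem//|h]; apply/mem_set.
  over.
rewrite /= integral_nneseries//; last first.
  move=> t; apply/measurable_realfun.measurable_EFinP; exact: (measurable_realfun.measurable_indic (mQ t)).
apply: eq_eseriesr => t _.
by rewrite (integral_indic P measurableT (mQ t)) setIT.
Qed.

Lemma fsum_setT (I : finType) (F : I -> \bar R) :
  \sum_(i \in [set: I]) F i = \sum_i F i.
Proof.
rewrite [RHS]fsbig_seq ?index_enum_uniq//.
by apply: eq_fsbigl; apply/seteqP; split=> // i _ /=; rewrite mem_index_enum.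
Qed.

Lemma measure_partition (I : finType) (X : T -> I) (A : set T) :
  measurable A -> (forall i, measurable (X @^-1` [set i])) ->
  P A = \sum_i P (A `&` X @^-1` [set i]).
Proof.
move=> mA mX; rewrite -fsum_setT -measure_fin_bigcup//; last 3 first.
- exact: finite_finset.
- by move=> i j _ _ [w /= [[_ <-] [_ <-]]].
- by move=> i _; exact: measurableI.
by congr (P _); apply/seteqP; split=> [w Aw|w [i _ []]//]; exists (X w).
Qed.

Lemma measure_bigcup_fin_le (I : finType) (F : I -> set T) :
  (forall i, measurable (F i)) ->
  P (\bigcup_i F i) <= \sum_i P (F i).
Proof.
move=> mF; rewrite -fsum_setT.
have fI : finite_set [set: I] by exact: finite_finset.
by apply: content_sub_fsum => //; exact: fin_bigcup_measurable.
Qed.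

End FirstTime.

(** * Avoidance probabilities, computed from the transition matrix alone *)

Section Survival.
Context (R : realType) (G : sgraph) (v : G).

(* The probability that the walk started at [x] avoids [v] during [0, t]. *)
Fixpoint survival (t : nat) (x : G) : R :=
  if t is s.+1 then (x != v)%:R * \sum_y srw_step R x y * survival s y
  else (x != v)%:R.

Lemma survival_target t : survival t v = 0.
Proof. by case: t => [|t] /=; rewrite eqxx ?mul0r. Qed.

Lemma survival_ge0 t x : 0 <= survival t x.
Proof.
elim: t x => [|t IH] x /=; first exact: ler0n.
by rewrite mulr_ge0 ?ler0n// sumr_ge0// => y _; rewrite mulr_ge0 ?srw_step_ge0.
Qed.

Lemma survival_antitone s t x : (s <= t)%N -> survival t x <= survival s x.
Proof.
move=> /subnK <-; elim: (t - s)%N => [|n] //; apply: le_trans; rewrite addSn.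
elim: (n + s)%N x => [|m IH] x /=.
  rewrite ler_piMr ?ler0n// -[leRHS](srw_step_sum1 R x) ler_sum// => y _.
  by rewrite ler_piMr ?srw_step_ge0// lern1 leq_b1.
rewrite ler_wpM2l ?ler0n// ler_sum// => y _.
by rewrite ler_wpM2l ?srw_step_ge0//; exact: IH.
Qed.

Lemma survival_le1 t x : survival t x <= 1.
Proof.
by apply: le_trans (survival_antitone x (leq0n t)) _; rewrite lern1 leq_b1.
Qed.

(** This is the Markov property at time [s]: wherever the walk then stands, it avoids [v] for [m]
    more steps with probability at most [q]. The induction peels off first steps. *)
Lemma survivalD_le m (q : R) : 0 <= q -> (forall x, survival m x <= q) ->
  forall s x, survival (s + m) x <= q * survival s x.
Proof.
move=> q0 mq; elim=> [|s IH] x.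
  by rewrite /=; case: eqVneq => [->|_]; rewrite ?survival_target ?mulr0 ?mulr1.
rewrite addSn /= mulrCA ler_wpM2l ?ler0n// mulr_sumr ler_sum// => y _.
by rewrite mulrCA ler_wpM2l ?srw_step_ge0.
Qed.

Lemma survival_expn m (q : R) : 0 <= q -> (forall x, survival m x <= q) ->
  forall r x, survival (r * m) x <= q ^+ r.
Proof.
move=> q0 mq; elim=> [|r IH] x; first by rewrite expr0 survival_le1.
rewrite mulSn addnC exprS (le_trans (survivalD_le q0 mq _ _))//.
by rewrite ler_wpM2l.
Qed.

(** From each vertex some path to [v] is followed with positive probability, and finiteness makes
    the bound uniform. This qualitative estimate serves to make hitting times finite. *)
Lemma survival_lt1 : connected_graph G -> exists (m : nat) (q : R),
  [/\ (0 < m)%N, 0 <= q < 1 & forall x, survival m x <= q].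
Proof.
move=> [_ Gc].
have ex x : exists t, survival t x < 1.
  have /connectP[p] := Gc x v.
  elim: p x => [|y p IH] x /= => [_ <-|/andP[xy yp] vE].
    by exists 0%N; rewrite survival_target ltr01.
  have [t yt] := IH y yp vE; exists t.+1 => /=.
  (* The next vertex [y] of the path has positive weight and survival below 1; the other terms are
     at most their weights, which sum to 1 with that of [y]. *)
  have: \sum_z srw_step R x z * survival t z < 1.
    rewrite -[ltRHS](srw_step_sum1 R x) (bigD1 y)//= [ltRHS](bigD1 y)//=.
    apply: ltr_leD; last first.
      by apply: ler_sum => z _; rewrite ler_piMr ?srw_step_ge0 ?survival_le1.
    have dx : (0 < degree x)%N by apply/card_gt0P; exists y.
    rewrite gtr_pMr// /srw_step -leqn0 leqNgt dx xy.
    by rewrite divr_gt0 ?ltr01 ?ltr0n.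
  by apply: le_lt_trans; case: eqP; rewrite ?mul1r ?mul0r ?sumr_ge0// => y' _;
    rewrite mulr_ge0 ?srw_step_ge0 ?survival_ge0.
have [T hT] := choice ex.
(* [m] exceeds every [T x], so antitonicity applies, and it is positive; the default 0 in the
   maximum gives [0 <= q]. *)
pose m := (\max_x T x).+1; pose q := \big[Num.max/0]_x survival m x.
have qx x : survival m x <= q by exact: le_bigmax.
exists m, q; split=> //; apply/andP; split; first exact: bigmax_ge_id.
apply: bigmax_lt => [|x _]; first exact: ltr01.
apply: le_lt_trans (hT x); apply: survival_antitone.
by rewrite leqW// leq_bigmax.
Qed.

End Survival.

(** * The avoidance probabilities of the actual process equal [survival] *)

Section Avoidance.
Context d (T : measurableType d) (R : realType) (P : probability T R).
Context (G : sgraph) (i : G) (X : nat -> T -> G).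
Hypothesis Xsrw : simple_random_walk P i X.

Let Pr (A : set T) : R := fine (P A).

Let PrE A : measurable A -> P A = (Pr A)%:E.
Proof. by move=> mA; rewrite fineK// fin_num_measure. Qed.

(** Such an event is a finite union, over the histories up to time [t] that satisfy [S], of finite
    intersections of preimages. *)
Lemma measurable_history (t : nat) (S : set (nat -> G)) :
  (forall x y : nat -> G, (forall s, (s <= t)%N -> x s = y s) -> S x -> S y) ->
  measurable [set w | S (X ^~ w)].
Proof.
move=> St; have [mX _ _] := Xsrw.
(* Beyond [t], [inord] falls back to index 0; these values are harmless since [S] looks only at
   times up to [t]. *)
pose ext (f : {ffun 'I_t.+1 -> G}) (s : nat) : G := f (inord s).
rewrite (_ : [set _ | _] = \bigcup_(f in [set f | S (ext f)])
    \bigcap_(s : 'I_t.+1) (X s @^-1` [set f s])).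
  by apply: fin_bigcup_measurable => // f _; exact: fin_bigcap_measurable.
have extE (f : {ffun 'I_t.+1 -> G}) w s : (s <= t)%N -> (forall r : 'I_t.+1, X r w = f r) ->
    ext f s = X s w.
  by move=> st /(_ (inord s)); rewrite /ext inordK.
apply/seteqP; split=> w /=.
  move=> Sw; pose f := [ffun s : 'I_t.+1 => X s w].
  have fw (r : 'I_t.+1) : X r w = f r by rewrite ffunE.
  exists f => [|r _] /=; last exact: fw.
  by apply: (St _ _ _ Sw) => s st; rewrite (extE f w).
by move=> [f /= Sf fw]; apply: (St _ _ _ Sf) => s st; apply: extE => // r; exact: fw.
Qed.

(** [srw_markov] speaks of single trajectories; summing it over the finitely many trajectories up to
    time [t] extends it to events of the past. *)
Lemma srw_markov_event (t : nat) (S : set (nat -> G)) (a b : G) :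
  (forall x y : nat -> G, (forall s, (s <= t)%N -> x s = y s) -> S x -> S y) ->
  P [set w | S (X ^~ w) /\ X t w = a /\ X t.+1 w = b] =
  (P [set w | S (X ^~ w) /\ X t w = a] * (srw_step R a b)%:E)%E.
Proof.
move=> St; have [mX _ Xm] := Xsrw.
pose tr w := [ffun s : 'I_t.+1 => X s w].
have trE w (f : {ffun 'I_t.+1 -> G}) :
    tr w = f <-> (forall s, (s <= t)%N -> X s w = f (inord s)).
  split=> [<- s st|h]; first by rewrite ffunE inordK.
  by apply/ffunP => s; rewrite ffunE h ?inord_val// -ltnS.
have mtr f : measurable (tr @^-1` [set f]).
  rewrite (_ : _ @^-1` _ = [set w | forall s, (s <= t)%N -> X s w = f (inord s)]).
    by apply: (@measurable_history t (fun x => forall s, (s <= t)%N -> x s = f (inord s)))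
      => x y xy h s st; rewrite -xy// h.
  by apply/seteqP; split=> w /trE.
have mA : measurable [set w | S (X ^~ w) /\ X t w = a].
  apply: (@measurable_history t (fun x => S x /\ x t = a)) => x y xy [Sx <-].
  by split; [exact: St Sx|rewrite xy].
have mB : measurable [set w | S (X ^~ w) /\ X t w = a /\ X t.+1 w = b].
  apply: (@measurable_history t.+1 (fun x => S x /\ x t = a /\ x t.+1 = b)).
  move=> x y xy [Sx [<- <-]]; split; last by rewrite !xy.
  by apply: (St _ _ _ Sx) => s st; apply: xy; exact: leqW.
rewrite (measure_partition P mB mtr) (measure_partition P mA mtr).
rewrite ge0_sume_distrl => [|f _]; last exact: measure_ge0.
apply: eq_bigr => f _; pose x s := f (inord s).
(* A trajectory violating [S] or not ending at [a] contributes 0 to both sides. *)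
have [[Sx xa]|nS] := pselect (S x /\ x t = a); last first.
  rewrite [X in P X = _](_ : _ = set0) ?[X in (P X * _)%E](_ : _ = set0).
  - by rewrite measure0 mul0e.
  - rewrite -subset0 => w [[Sw wa] /trE wf]; apply: nS; rewrite /x -wf//.
    by split=> //; apply: (St _ _ _ Sw) => s /wf.
  - rewrite -subset0 => w [[Sw [wa _]] /trE wf]; apply: nS; rewrite /x -wf//.
    by split=> //; apply: (St _ _ _ Sw) => s /wf.
(* The trajectory is prolonged by [b] at time [t.+1], so that [srw_markov] applies to it. *)
pose z s := if (s <= t)%N then x s else b.
have zt : z t = a by rewrite /z leqnn.
have zS : z t.+1 = b by rewrite /z ltnn.
rewrite -[in RHS]zt -[in RHS]zS.
rewrite (_ : _ `&` _ = [set w | forall s, (s <= t.+1)%N -> X s w = z s]); last first.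
  apply/seteqP; split=> w /=.
    move=> [[_ [_ wb]] /trE wf] s; rewrite leq_eqVlt => /predU1P[->|st].
      by rewrite zS.
    by rewrite /z -ltnS st; apply: wf.
  move=> wz; have wx s : (s <= t)%N -> X s w = x s.
    by move=> st; rewrite wz ?leqW// /z st.
  split; last by apply/trE.
  by rewrite wx// xa (wz t.+1)//; split=> //; apply: (St _ _ _ Sx) => s /wx.
rewrite Xm; congr (P _ * _)%E; apply/seteqP; split=> w /=.
  move=> wz; have wx s : (s <= t)%N -> X s w = x s.
    by move=> st; rewrite wz// /z st.
  split; last by apply/trE.
  by rewrite wx// zt xa; split=> //; apply: (St _ _ _ Sx) => s /wx.
by move=> [_ /trE wf] s st; rewrite /z st wf.
Qed.

Context (v : G).

Definition avoids (t : nat) : set T := [set w | forall s, (s <= t)%N -> X s w <> v].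

Lemma measurable_avoids t : measurable (avoids t).
Proof.
apply: (@measurable_history t (fun x => forall s, (s <= t)%N -> x s <> v)).
by move=> x y xy h s st; rewrite -xy//; exact: h.
Qed.

(** The law at time [t] of the walk killed on reaching [v]. *)
Let mu t y := Pr (avoids t `&` X t @^-1` [set y]).

Let m_mu t y : measurable (avoids t `&` X t @^-1` [set y]).
Proof.
have [mX _ _] := Xsrw.
by apply: measurableI; [exact: measurable_avoids|exact: mX].
Qed.

Let mu_target t : mu t v = 0.
Proof.
rewrite /mu (_ : _ `&` _ = set0) /Pr ?measure0//.
by rewrite -subset0 => w [/(_ t (leqnn t))].
Qed.

(** The forward equation of the killed walk: it conditions on the last step, whereas [survival]
    recurses on the first. *)
Let muS t y : y != v -> mu t.+1 y = \sum_x mu t x * srw_step R x y.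
Proof.
move=> yv; have [mX _ _] := Xsrw; apply: EFin_inj.
rewrite -PrE// (measure_partition P (m_mu t.+1 y) (mX t)) -sumEFin.
apply: eq_bigr => x _; rewrite EFinM -PrE//.
pose S := [set z : nat -> G | forall s, (s <= t)%N -> z s <> v].
have St (z z' : nat -> G) : (forall s, (s <= t)%N -> z s = z' s) -> S z -> S z'.
  by move=> zz' h s st; rewrite -zz'//; exact: h.
apply: etrans (srw_markov_event x y St).
congr (P _); apply/seteqP; split=> w /=.
  by move=> [[wa wy] wx]; split=> // s st; apply: wa; exact: leqW.
move=> [wa [wx wy]]; split=> //; split=> // s.
by rewrite leq_eqVlt => /predU1P[->|/wa//]; rewrite wy; exact/eqP.
Qed.

(* Moving one step from [mu] to [survival] interpolates between the law of the
   walk ([s = 0]) and the recursion defining [survival] ([t = 0]). *)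
Let avoidsD t s : Pr (avoids (t + s)) = \sum_y mu t y * survival R v s y.
Proof.
have [mX _ _] := Xsrw.
elim: s t => [|s IH] t.
  rewrite addn0; apply: EFin_inj.
  rewrite -PrE; last exact: measurable_avoids.
  rewrite (measure_partition P (measurable_avoids t) (mX t)) -sumEFin.
  apply: eq_bigr => y _; rewrite PrE//= -/(mu t y).
  by case: eqVneq => [->|_]; rewrite ?mulr1// mu_target mul0r.
rewrite addnS -addSn IH (bigD1 v)//= survival_target mulr0 add0r.
under eq_bigr => y yv do rewrite muS// mulr_suml.
rewrite exchange_big/=; apply: eq_bigr => x _.
case: (eqVneq x v) => [->|_].
  by rewrite mu_target mul0r big1// => y _; rewrite !mul0r.
rewrite mul1r [in RHS](bigD1 v)//= survival_target mulr0 add0r mulr_sumr.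
by apply: eq_bigr => y _; rewrite mulrA.
Qed.

(** Take [t = 0] in [avoidsD]: the killed law at time 0 is the point mass at [i], or zero if
    [i = v]. *)
Lemma probability_avoids t : P (avoids t) = (survival R v t i)%:E.
Proof.
have [mX X0 _] := Xsrw.
rewrite PrE; last exact: measurable_avoids.
rewrite -[t]add0n avoidsD (bigD1 i)//= big1 => [|y yi]; last first.
  suff -> : mu 0 y = 0 by rewrite mul0r.
  apply: EFin_inj; rewrite -PrE//; apply/eqP; rewrite eq_le measure_ge0 andbT.
  (* The walk starts at [i] only almost surely, so other starting points are handled through a null
     set. *)
  have i0 : P (~` (X 0%N @^-1` [set i])) = 0%E.
    rewrite probability_setC; last exact: mX.
    by rewrite [X in (1 - X)%E]X0 subee.
  rewrite -[leRHS]i0.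
  apply: le_measure; rewrite ?inE//; first by apply: measurableC; exact: mX.
  by move=> w [_ /= ->]; exact/eqP.
rewrite addr0; case: (eqVneq i v) => [->|iv]; first by rewrite survival_target mulr0.
suff -> : mu 0 i = 1 by rewrite mul1r.
apply: EFin_inj; rewrite -PrE// -X0; congr (P _); apply/seteqP.
split=> w /= => [[]//|wi]; split=> // s; rewrite leqn0 => /eqP ->.
by rewrite wi; exact/eqP.
Qed.

End Avoidance.

(** * Block and geometric estimates for sums *)

(** Cut time into blocks of length [m]; by monotonicity each term of block [r] is at most the first
    one, [u (r * m)]. *)
Lemma ler_sum_blocks (R : numDomainType) (u g : nat -> R) (m : nat) :
  (0 < m)%N -> (forall t, 0 <= u t) ->
  (forall s t, (s <= t)%N -> u t <= u s) ->
  (forall r, u (r * m)%N <= g r) ->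
  forall T, \sum_(0 <= t < T) u t <= m%:R * \sum_(0 <= r < T) g r.
Proof.
move=> m0 u0 u_anti ug T; apply: (@le_trans _ _ (\sum_(0 <= t < T * m) u t)).
  rewrite [leRHS](big_cat_nat (n := T)) ?leq_pmulr//= lerDl.
  by apply: sumr_ge0 => t _; exact: u0.
elim: T => [|T IH]; first by rewrite !big_nil mulr0.
rewrite (big_cat_nat (n := T * m)) ?leq_pmul2r//= big_nat_recr//= mulrDr lerD//.
apply: (@le_trans _ _ (\sum_(T * m <= t < T.+1 * m) g T)).
  by apply: ler_sum_nat => t /andP[Tt _]; apply: le_trans (ug T); exact: u_anti.
by rewrite big_const_nat iter_addr addr0 mulSn addnK mulr_natl.
Qed.

Lemma sum_geometric_le (R : realFieldType) (q : R) (n : nat) :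
  0 <= q < 1 -> \sum_(0 <= r < n) q ^+ r <= (1 - q)^-1.
Proof.
move=> /andP[q0 q1]; rewrite -[leRHS]mul1r ler_pdivlMr ?subr_gt0// big_mkord.
have := subrX1 q n; have := exprn_ge0 n q0; lra.
Qed.

Lemma nneseries_le (R : realType) (u : nat -> R) (B : R) :
  (forall t, 0 <= u t) -> (forall T, \sum_(0 <= t < T) u t <= B) ->
  (\sum_(0 <= t <oo) (u t)%:E <= B%:E)%E.
Proof.
move=> u0 uB; apply: lime_le.
  by apply: is_cvg_nneseries => t _ _; rewrite lee_fin.
by apply: nearW => T; rewrite sumEFin lee_fin.
Qed.

(** * Hitting times *)

Section Times.
Context (R : realType) (W : walks_choice R) (G : sgraph).

Lemma hitting_timeE (u v : G) :
  hitting_time W u v = (\sum_(0 <= t <oo) (survival R v t u)%:E)%E.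
Proof.
have Xsrw := walk_srw (W 1%N u) ord0.
rewrite /hitting_time expectation_first_time; last first.
  by move=> t; exact: measurable_avoids Xsrw v t.
by apply: eq_eseriesr => t _; exact: probability_avoids Xsrw v t.
Qed.

(** Markov's inequality, read off the tail sum: each of its first [m] terms is at least
    [survival R v m u]. *)
Lemma survival_hitting_time (u v : G) m :
  ((m%:R * survival R v m u)%:E <= hitting_time W u v)%E.
Proof.
rewrite hitting_timeE; apply: le_trans (nneseries_lim_ge m _); last first.
  by move=> t _ _; rewrite lee_fin survival_ge0.
rewrite sumEFin lee_fin mulr_natl -[X in _ *+ X]subn0 -[leLHS]addr0 -iter_addr.
rewrite -big_const_nat; apply: ler_sum_nat => t /andP[_ tm].
by apply: survival_antitone; exact: ltnW.
Qed.

Lemma hitting_time_ge1 (u v : G) : u != v -> (1 <= hitting_time W u v)%E.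
Proof.
move=> uv; rewrite hitting_timeE.
apply: le_trans (nneseries_lim_ge 1 _); last first.
  by move=> t _ _; rewrite lee_fin survival_ge0.
by rewrite big_nat1/= uv.
Qed.

Lemma hitting_time_lty (u v : G) :
  connected_graph G -> (hitting_time W u v < +oo)%E.
Proof.
move=> Gc; have [m [q [m0 q01 mq]]] := survival_lt1 R v Gc.
have q0 : 0 <= q by case/andP: q01.
apply: le_lt_trans (ltry (m%:R * (1 - q)^-1)); rewrite hitting_timeE.
apply: nneseries_le => [t|T]; first exact: survival_ge0.
apply: (@le_trans _ _ (m%:R * \sum_(0 <= r < T) q ^+ r)).
  apply: ler_sum_blocks => //.
  - by move=> t; exact: survival_ge0.
  - by move=> s t; exact: survival_antitone.
  - by move=> r; exact: survival_expn.
by rewrite ler_wpM2l// sum_geometric_le.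
Qed.

Lemma hitting_time_le_max (u v : G) :
  (hitting_time W u v <= max_hitting_time W G)%E.
Proof.
apply: (@le_trans _ _ (\big[maxe/-oo]_(w : G) hitting_time W u w)%E).
  exact: (le_bigmax _ (fun w => hitting_time W u w)).
exact: (le_bigmax _ (fun u => \big[maxe/-oo]_(w : G) hitting_time W u w)%E).
Qed.

Lemma max_hitting_time_lty :
  connected_graph G -> (max_hitting_time W G < +oo)%E.
Proof.
move=> Gc; apply: bigmax_lt => [|u _] //.
by apply: bigmax_lt => [|v _] //; exact: hitting_time_lty.
Qed.

(** Needed to apply [independent_processes] to avoidance events. *)
Lemma process_sigma_algebra_avoids d (T : measurableType d) (X : nat -> T -> G) v t :
  process_sigma_algebra X (avoids X v t).
Proof.
rewrite (_ : avoids X v t = setT `\`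
    \bigcup_s (if (s <= t)%N then X s @^-1` [set v] else set0)); last first.
  apply/seteqP; split=> w /=.
    by move=> wa; split=> // -[s _]; case: ifP => // /wa.
  by move=> [_ wa] s st sv; apply: wa; exists s => //; rewrite st.
apply: sigma_algebraCD; apply: sigma_algebra_bigcup => s.
case: ifP => _; last exact: sigma_algebra0.
by apply: sub_sigma_algebra; exists s, v.
Qed.

(** * The cover time of [k] independent walks *)

Section Cover.
Context (k : nat) (i : G).
Let P := walks_prob (W k i).
Let X := walk (W k i).

Let uncovered t := [set w | forall s, (s <= t)%N -> ~ Defs.covered_by X w s].

(** Coverage is monotone in time, so only time [t] matters, and there some vertex has been missed by
    all walks. *)
Let uncoveredE t : uncovered t = \bigcup_v \bigcap_j avoids (X j) v t.
Proof.
apply/seteqP; split=> w.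
  move=> /(_ t (leqnn t)) /existsNP[v nv]; exists v => // j _ s st sv.
  by apply: nv; exists j, s.
move=> [v _ wv] s st /(_ v)[j [r [rs rv]]].
exact: wv j I r (leq_trans rs st) rv.
Qed.

Let measurable_avoids_all v t : measurable (\bigcap_j avoids (X j) v t).
Proof.
apply: fin_bigcap_measurable => [|j _]; first exact: finite_finset.
exact: measurable_avoids (walk_srw (W k i) j) v t.
Qed.

Let measurable_uncovered t : measurable (uncovered t).
Proof.
rewrite uncoveredE; apply: fin_bigcup_measurable => [|v _].
  exact: finite_finset.
exact: measurable_avoids_all.
Qed.

Let p t := fine (P (uncovered t)).

Let pE t : P (uncovered t) = (p t)%:E.
Proof. by rewrite fineK// fin_num_measure. Qed.

(** Union bound over the missed vertex [v]; independence turns the joint avoidance into a [k]-th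
    power. *)
Let p_le t : p t <= \sum_v survival R v t i ^+ k.
Proof.
rewrite -lee_fin -pE uncoveredE -sumEFin.
apply: le_trans (measure_bigcup_fin_le _ _) _ => //.
apply: lee_sum => v _.
rewrite (_ : \bigcap_j _ = \bigcap_(j in [set` [set: 'I_k]%SET]) avoids (X j) v t).
  rewrite walk_indep => [|j _]; last exact: process_sigma_algebra_avoids.
  under eq_bigr => j _ do
    rewrite (probability_avoids (walk_srw (W k i) j) v t).
  by rewrite prodEFin prodr_const cardsT card_ord.
by apply/seteqP; split=> w h j _; apply: h => //=; rewrite inE.
Qed.

(** In blocks of length [m], the first [r0] tail probabilities are bounded by 1; later ones decay
    geometrically, since by then [q ^+ (r0 * k)] has absorbed the factor [#|G|] of the union
    bound. *)
Lemma cover_time_from_le m (q : R) r0 :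
  (0 < k)%N -> (0 < m)%N -> 0 <= q < 1 ->
  (forall v x : G, survival R v m x <= q) ->
  #|G|%:R * q ^+ (r0 * k) <= 1 ->
  (cover_time_from W k i <= (m%:R * (r0%:R + (1 - q)^-1))%:E)%E.
Proof.
move=> k0 m0 /[dup] q01 /andP[q0 q1] mq nq.
rewrite /cover_time_from expectation_first_time -/P -/X//.
under eq_eseriesr => t _ do rewrite pE.
have p0 t : 0 <= p t by rewrite -lee_fin -pE measure_ge0.
apply: nneseries_le => // T.
pose g r := if (r < r0)%N then 1 else q ^+ (r - r0).
have g0 r : 0 <= g r by rewrite /g; case: ifP => // _; exact: exprn_ge0.
apply: (@le_trans _ _ (m%:R * \sum_(0 <= r < T) g r)).
  apply: ler_sum_blocks => //.
    move=> s t st; rewrite -lee_fin -!pE; apply: le_measure; rewrite ?inE//.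
    by move=> w wt r rs; apply: wt; exact: leq_trans st.
  move=> r; rewrite /g; case: ltnP => [_|r0r].
    by rewrite -lee_fin -pE probability_le1.
  apply: le_trans (p_le _) _.
  apply: (@le_trans _ _ (#|G|%:R * q ^+ (r * k))).
    rewrite mulr_natl -sumr_const ler_sum// => v _; rewrite exprM.
    by apply: lerXn2r; rewrite ?nnegrE ?survival_ge0 ?exprn_ge0//; exact: survival_expn.
  rewrite -{1}(subnK r0r) mulnDl exprD mulrCA.
  (* After block [r0] one factor [q] per block suffices, so the exponent [k] is dropped using
     [1 <= k]. *)
  apply: (@le_trans _ _ (q ^+ ((r - r0) * k))).
    by rewrite ler_piMr ?exprn_ge0.
  by rewrite ler_wiXn2l ?leq_pmulr// ltW.
rewrite ler_wpM2l//.
(* Lengthening the sum allows splitting it at [r0] even when [T < r0]. *)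
apply: (@le_trans _ _ (\sum_(0 <= r < r0 + T) g r)).
  rewrite [leRHS](big_cat_nat (n := T)) ?leq_addl//= lerDl.
  by apply: sumr_ge0 => r _; exact: g0.
rewrite (big_cat_nat (n := r0)) ?leq_addr//= lerD//.
  rewrite (eq_big_nat _ _ (F2 := fun=> 1)) => [|r /andP[_ rr0]]; last by rewrite /g rr0.
  by rewrite big_const_nat subn0 iter_addr addr0.
rewrite -{1}[r0]add0n big_addn addKn (eq_bigr (fun r => q ^+ r)) => [|r _].
  exact: sum_geometric_le.
by rewrite /g ltnNge leq_addl/= addnK.
Qed.

End Cover.

End Times.

(** * Choice of constants and the speed-up bound *)

Lemma kcover_time_le (R : realType) (W : walks_choice R) (G : sgraph) (k : nat) (H : R) :
  connected_graph G -> (1 < #|G|)%N -> max_hitting_time W G = H%:E ->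
  (1 <= k)%N -> k%:R <= ln (#|G|%:R : R) ->
  (kcover_time W G k <=
    ((expR 1 + 1) * (2 + (1 - expR (-1))^-1) * H * ln #|G|%:R / k%:R)%:E)%E.
Proof.
move=> Gc n1 HE k1 kn; set n : R := #|G|%:R; set L := ln n.
set e : R := expR 1; set q : R := expR (-1).
have kR : (0 < k%:R :> R) by rewrite ltr0n.
have q0 : 0 < q by exact: expR_gt0.
have q1 : q < 1 by rewrite expR_lt1 ltrN10.
have e0 : 0 < e by exact: expR_gt0.
have qe : q * e = 1 by rewrite /q /e expRN mulVf// gt_eqF.
have H1 : 1 <= H.
  have /card_gt1P[u [v [_ _ uv]]] := n1.
  rewrite -lee_fin -HE; apply: le_trans (hitting_time_ge1 W uv) _.
  exact: hitting_time_le_max.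
(* The least natural above [e * H]: Markov's inequality then gives avoidance probability at most
   1/e. *)
pose m := (Num.truncn (e * H)).+1.
have H0 : 0 <= H by exact: le_trans H1.
have /andP[m_le m_gt] : (m.-1%:R <= e * H < m%:R).
  by apply: truncn_itv; rewrite mulr_ge0// ltW.
have mE : m%:R = m.-1%:R + 1 :> R by rewrite -natr1.
(* The least natural above [L / k], so that [q ^+ (r0 * k)], being exp(-r0 k), is at most 1/n. *)
pose r0 := (Num.truncn (L / k%:R)).+1.
have L0 : 0 <= L by apply: le_trans kn.
have /andP[r_le r_gt] : (r0.-1%:R <= L / k%:R < r0%:R).
  by apply: truncn_itv; rewrite divr_ge0.
have rE : r0%:R = r0.-1%:R + 1 :> R by rewrite -natr1.
have Lk : 1 <= L / k%:R by rewrite ler_pdivlMr// mul1r.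
(* Markov's inequality, with [m > e H]. *)
have mq (v x : G) : survival R v m x <= q.
  have : m%:R * survival R v m x <= H.
    rewrite -lee_fin -HE; apply: le_trans (survival_hitting_time W x v m) _.
    exact: hitting_time_le_max.
  have s0 := survival_ge0 R v m x => sH.
  rewrite -(ler_pM2r e0) qe -(ler_pM2r (lt_le_trans ltr01 H1)) mul1r -mulrA.
  by apply: le_trans sH; rewrite mulrC ler_wpM2r// ltW.
have nq : n * q ^+ (r0 * k) <= 1.
  have n0 : 0 < n by rewrite ltr0n; exact: ltn_trans n1.
  rewrite -[n]lnK ?posrE// -/L /q -expRM_natr -expRD -[leRHS]expR0 ler_expR mulN1r subr_le0.
  by rewrite natrM -ler_pdivrMr// ltW.
have D0 : 0 <= (1 - q)^-1 by rewrite invr_ge0 subr_ge0 ltW.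
apply: bigmax_le => [|i _]; first by rewrite leNye.
apply: le_trans (cover_time_from_le W i (q := q) (m := m) (r0 := r0) _ _ _ _ _) _ => //.
  by rewrite q1 ltW.
rewrite lee_fin.
(* The additive constants from rounding and from the geometric tail are absorbed: [1 <= H] gives
   [m <= (e + 1) * H], and [1 <= L / k], which is [k <= log n], bounds the other factor. *)
apply: (@le_trans _ _ ((e + 1) * H * ((2 + (1 - q)^-1) * (L / k%:R)))).
  apply: ler_pM => //.
  - by rewrite addr_ge0.
  - by rewrite mE mulrDl mul1r lerD.
  - rewrite rE mulrDl lerD//; last by rewrite ler_peMr.
    by rewrite mulr_natl mulr2n lerD.
by rewrite !mulrA (mulrAC (e + 1)).
Qed.

Theorem theorem4 (R : realType) (W : walks_choice R)
    (I : Type) (Iinf : infinite_set [set: I]) (G : I -> sgraph)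
    (Gconn : forall j, connected_graph (G j))
    (GTheta : exists (a1 a2 : R) (N0 : nat), 0 < a1 /\ 0 < a2 /\
       forall j, (N0 <= #|G j|)%N ->
         (a1%:E * max_hitting_time W (G j) * (ln (#|G j|%:R : R))%:E
            <= cover_time W (G j)
            <= a2%:E * max_hitting_time W (G j) * (ln (#|G j|%:R : R))%:E)%E) :
  exists (c : R) (N : nat), 0 < c /\
    forall j, (N <= #|G j|)%N ->
      forall k : nat, (1 <= k)%N -> k%:R <= ln (#|G j|%:R : R) ->
        (c%:E * k%:R%:E <= speedup W (G j) k)%E.
Proof.
have [a1 [a2 [N0 [a1_gt0 [_ Ctheta]]]]] := GTheta.
(* The constant of [kcover_time_le]: the [k]-walk cover time is at most [B * H * L / k], while the
   cover time is at least [a1 * H * L], whence [c = a1 / B]. *)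
pose B : R := (expR 1 + 1) * (2 + (1 - expR (-1))^-1).
have B0 : 0 < B.
  have e1 : expR (-1) < 1 :> R by rewrite expR_lt1 ltrN10.
  by apply: mulr_gt0; apply: addr_gt0; rewrite ?expR_gt0 ?invr_gt0 ?subr_gt0.
exists (a1 / B), N0; split=> [|j Nj k k1 kn]; first by rewrite divr_gt0.
have kR : (0 < k%:R :> R) by rewrite ltr0n.
(* Otherwise [ln #|G j|] would be at most 0, against [1 <= k <= ln #|G j|]. *)
have n1 : (1 < #|G j|)%N.
  rewrite ltnNge; apply/negP => n1; move: kn; rewrite leNgt => /negP; apply.
  by apply: le_lt_trans kR; apply: ln_le0; rewrite lern1.
have /card_gt1P[u [v [_ _ uv]]] := n1.
have H1 : (1 <= max_hitting_time W (G j))%E.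
  exact: le_trans (hitting_time_ge1 W uv) (hitting_time_le_max W u v).
have /fineK/esym HE : max_hitting_time W (G j) \is a fin_num.
  rewrite ge0_fin_numE ?max_hitting_time_lty//; exact: le_trans H1.
set H := fine _ in HE; set L := ln _ in kn.
have H0 : 0 < H by rewrite -lte_fin -HE; exact: lt_le_trans H1.
have L0 : 0 < L by exact: lt_le_trans kn.
have := kcover_time_le (Gconn j) n1 HE k1 kn.
rewrite -/B -/L; set x := kcover_time W (G j) k => xB.
have /andP[+ _] := Ctheta j Nj; rewrite HE -/L -!EFinM => C_ge.
rewrite /speedup -/x.
have C_gt0 : (0 < cover_time W (G j))%E.
  by apply: lt_le_trans C_ge; rewrite lte_fin !mulr_gt0.
have x0 : (0 <= x)%E.
  apply: le_trans (le_bigmax _ (cover_time_from W k) u).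
  apply: integral_ge0 => w _; apply: le_ereal_inf_tmp => _ [t _ <-].
  by rewrite lee_fin.
have /fineK xE : x \is a fin_num by rewrite ge0_fin_numE// (le_lt_trans xB) ?ltry.
(* If [x] were 0, its inverse would be +oo by convention and the positive cover time would make the
   speed-up +oo. *)
move: x0 xB; rewrite -xE !lee_fin le_eqVlt => /predU1P[<- _|x0 xB].
  by rewrite inve0 gt0_muley// leey.
rewrite inver gt_eqF// lee_pdivlMr//; apply: le_trans C_ge.
rewrite -EFinM lee_fin; apply: (@le_trans _ _ (a1 / B * k%:R * (B * H * L / k%:R))).
  by rewrite ler_wpM2l// mulr_ge0// ?divr_ge0// ltW.
rewrite le_eqVlt; apply/orP; left; apply/eqP.
have -> : a1 / B * k%:R * (B * H * L / k%:R) = a1 * H * L * (B / B) * (k%:R / k%:R).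
  by rewrite !mulrA; lra.
by rewrite !divff ?mulr1// gt_eqF.
Qed.
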